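(* For every set $\Phi$ of primitive propositions, Levesque's axiomatization is sound and complete for the language $\mathcal{ONL}(\Phi)$ with respect to the extended-situation semantics $\models^x$; that is, for every formula $\alpha\in\mathcal{ONL}(\Phi)$, $\alpha$ is provable in Levesque's axiom system if and only if $(W_L,W_N,w)\models^x\alpha$ for every extended situation $(W_L,W_N,w)$.
   Context: Language: $\mathcal{ONL}(\Phi)$ is the propositional modal language formed from the primitive propositions in $\Phi$ by closing off under $\neg,\lor$ and two unary modalities $L$ and $N$ (other connectives are abbreviations). An objective formula is one without modal operators. A subjective formula is a Boolean combination of formulas of the form $L\varphi$ or $N\varphi$. Levesque's axiom system. Axioms: A1: all instances of axioms of propositional logic. A2: $L(\alpha\Rightarrow\beta)\Rightarrow(L\alpha\Rightarrow L\beta)$. A3: $N(\alpha\Rightarrow\beta)\Rightarrow(N\alpha\Rightarrow N\beta)$. A4: $\sigma\Rightarrow L\sigma\land N\sigma$ for every subjective formula $\sigma$. A5: $N\alpha\Rightarrow\neg L\alpha$ if $\neg\alpha$ is a propositionally consistent objective formula. Inference rules: MP (from $\alpha$ and $\alpha\Rightarrow\beta$ infer $\beta$); Nec (from $\alpha$ infer $L\alpha$ and $N\alpha$). Semantics: a world is a truth assignment to $\Phi$. An extended situation is a triple $(W_L,W_N,w)$ where $w$ is a world and $W_L,W_N$ are sets of worlds such that $W_L\cup W_N$ is the set of all truth assignments to $\Phi$ ($W_L$ and $W_N$ may overlap, may be empty, and $w$ is arbitrary). The relation $\models^x$ is defined by: $(W_L,W_N,w)\models^x p$ iff $w$ makes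 $p$ true, for $p\in\Phi$; the usual clauses for $\neg,\lor$; $(W_L,W_N,w)\models^x L\alpha$ iff $(W_L,W_N,w')\models^x\alpha$ for all $w'\in W_L$; $(W_L,W_N,w)\models^x N\alpha$ iff $(W_L,W_N,w')\models^x\alpha$ for all $w'\in W_N$. *)

(* Defs.v *)
From mathcomp Require Import all_boot all_classical.

Set Implicit Arguments.
Unset Strict Implicit.
Unset Printing Implicit Defensive.

Local Open Scope classical_set_scope.

Inductive form (Phi : Type) : Type :=
  | Var of Phi
  | Neg of form Phi
  | Or of form Phi & form Phi
  | L of form Phi
  | N of form Phi.

Definition And Phi (a b : form Phi) : form Phi := Neg (Or (Neg a) (Neg b)).
Definition Imp Phi (a b : form Phi) : form Phi := Or (Neg a) b.

Fixpoint objective Phi (a : form Phi) : bool :=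
  match a with
  | Var _ => true
  | Neg b => objective b
  | Or b c => objective b && objective c
  | L _ | N _ => false
  end.

Fixpoint subjective Phi (a : form Phi) : bool :=
  match a with
  | Var _ => false
  | Neg b => subjective b
  | Or b c => subjective b && subjective c
  | L _ | N _ => true
  end.

(* Kleene-style axiom schemes for classical propositional logic, limited to the
   connectives of the language; the schemes for conjunction are not needed, as
   conjunction is an abbreviation. *)
Inductive prop_axiom Phi : form Phi -> Prop :=
  | prop_K a b : prop_axiom (Imp a (Imp b a))
  | prop_S a b c :
      prop_axiom (Imp (Imp a (Imp b c)) (Imp (Imp a b) (Imp a c)))
  | prop_orl a b : prop_axiom (Imp a (Or a b))
  | prop_orr a b : prop_axiom (Imp b (Or a b))
  | prop_or_elim a b c :
      prop_axiom (Imp (Imp a c) (Imp (Imp b c) (Imp (Or a b) c)))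
  | prop_neg_intro a b :
      prop_axiom (Imp (Imp a b) (Imp (Imp a (Neg b)) (Neg a)))
  | prop_neg_elim a : prop_axiom (Imp (Neg (Neg a)) a).

(* The propositional calculus on objective formulas. Modus ponens needs no side
   condition: if [Imp a b] is objective, then so are [a] and [b]. *)
Inductive prop_provable Phi : form Phi -> Prop :=
  | prop_ax a : objective a -> prop_axiom a -> prop_provable a
  | prop_MP a b : prop_provable a -> prop_provable (Imp a b) -> prop_provable b.

Definition prop_consistent Phi (a : form Phi) : Prop :=
  ~ prop_provable (Neg a).

Inductive provable Phi : form Phi -> Prop :=
  | ax_A1 a : prop_axiom a -> provable a
  | ax_A2 a b : provable (Imp (L (Imp a b)) (Imp (L a) (L b)))
  | ax_A3 a b : provable (Imp (N (Imp a b)) (Imp (N a) (N b)))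
  | ax_A4 s : subjective s -> provable (Imp s (And (L s) (N s)))
  | ax_A5 a : objective (Neg a) -> prop_consistent (Neg a) ->
      provable (Imp (N a) (Neg (L a)))
  | rule_MP a b : provable a -> provable (Imp a b) -> provable b
  | rule_NecL a : provable a -> provable (L a)
  | rule_NecN a : provable a -> provable (N a).

Definition world (Phi : Type) : Type := Phi -> bool.

Record ext_situation (Phi : Type) : Type := ExtSituation {
  WL : set (world Phi);
  WN : set (world Phi);
  actual : world Phi;
  WL_WN_cover : WL `|` WN = [set: world Phi]
}.

Definition move_to Phi (s : ext_situation Phi) (w : world Phi) :
  ext_situation Phi := ExtSituation w (WL_WN_cover s).

Fixpoint models Phi (s : ext_situation Phi) (a : form Phi) : Prop :=
  match a with
  | Var p => actual s p
  | Neg b => ~ models s b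
  | Or b c => models s b \/ models s c
  | L b => forall w, WL s w -> models (move_to s w) b
  | N b => forall w, WN s w -> models (move_to s w) b
  end.

(* Main.v *)
(** Canonical models, with no countability assumption on [Phi]. Fix a maximal
    consistent set [G] containing all theorems and omitting the unprovable
    formula, and let W_L (resp. W_N) consist of the worlds of the maximal
    consistent sets containing every [a] with [L a] (resp. [N a]) in [G]. By A4
    all these sets agree on subjective formulas, which gives the truth lemma.
    A5 says exactly that W_L and W_N cover all worlds: were [w] in neither,
    compactness would give objective formulas [a], [b] false at [w] with [L a]
    and [N b] in [G], and A5 applied to the disjunction of [a] and [b] would
    contradict the consistency of [G]. Conversely, soundness of A5 is the
    completeness of propositional logic. *)
From mathcomp Require Import all_boot all_classical.
Require Import Defs.

Set Implicit Arguments.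
Unset Strict Implicit.
Unset Printing Implicit Defensive.

Local Open Scope classical_set_scope.

(** * Propositional derivability from hypotheses *)

(** There is no necessitation here, so the deduction theorem holds without restriction; modal
    theorems enter only as hypotheses. *)
Inductive der Phi (T : set (form Phi)) : form Phi -> Prop :=
  | der_ax a : prop_axiom a -> der T a
  | der_hyp a : T a -> der T a
  | der_MP a b : der T a -> der T (Imp a b) -> der T b.

Lemma der_cut Phi (T T' : set (form Phi)) a :
  (forall b, T b -> der T' b) -> der T a -> der T' a.
Proof.
move=> TT'; elim=> {a} [a ax|a /TT' //|a b _ IHa _ IHb]; first exact: der_ax.
exact: der_MP IHa IHb.
Qed.

Lemma der_sub Phi (T T' : set (form Phi)) a :
  T `<=` T' -> der T a -> der T' a.
Proof. by move=> TT'; apply: der_cut => b /TT'; exact: der_hyp. Qed.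

Lemma der_hypU Phi (T : set (form Phi)) a : der (T `|` [set a]) a.
Proof. by apply: der_hyp; right. Qed.

Lemma der_wkn Phi (T : set (form Phi)) a b : der T b -> der (T `|` [set a]) b.
Proof. by apply: der_sub => c; left. Qed.

Lemma der_K Phi (T : set (form Phi)) a b : der T b -> der T (Imp a b).
Proof. by move=> Tb; apply: der_MP Tb _; apply/der_ax/prop_K. Qed.

Lemma der_deduction Phi (T : set (form Phi)) a b :
  der (T `|` [set a]) b -> der T (Imp a b).
Proof.
elim=> {b} [b ax|b [Tb|->]|b c _ IHb _ IHc].
- exact/der_K/der_ax.
- exact/der_K/der_hyp.
- have Ka := der_ax T (prop_K a (Imp a a)).
  apply: der_MP (der_ax T (prop_K a a)) _.
  by apply: der_MP Ka _; apply/der_ax/prop_S.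
- by apply: der_MP IHb _; apply: der_MP IHc _; apply/der_ax/prop_S.
Qed.

Lemma der_negI Phi (T : set (form Phi)) a b :
  der (T `|` [set a]) b -> der (T `|` [set a]) (Neg b) -> der T (Neg a).
Proof.
move=> /der_deduction ab /der_deduction anb.
by apply: der_MP anb _; apply: der_MP ab _; apply/der_ax/prop_neg_intro.
Qed.

Lemma der_exfalso Phi (T : set (form Phi)) a b :
  der T b -> der T (Neg b) -> der T a.
Proof.
move=> Tb Tnb; have : der T (Neg (Neg a)).
  by apply: (@der_negI _ _ _ b); exact: der_wkn.
by move=> /der_MP; apply; apply/der_ax/prop_neg_elim.
Qed.

Lemma der_orl Phi (T : set (form Phi)) a b : der T a -> der T (Or a b).
Proof. by move=> /der_MP; apply; apply/der_ax/prop_orl. Qed.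

Lemma der_orr Phi (T : set (form Phi)) a b : der T b -> der T (Or a b).
Proof. by move=> /der_MP; apply; apply/der_ax/prop_orr. Qed.

Lemma der_orE Phi (T : set (form Phi)) a b c : der T (Or a b) ->
  der (T `|` [set a]) c -> der (T `|` [set b]) c -> der T c.
Proof.
move=> ab /der_deduction ac /der_deduction bc; apply: der_MP ab _.
by apply: der_MP bc _; apply: der_MP ac _; apply/der_ax/prop_or_elim.
Qed.

Lemma der_em Phi (T : set (form Phi)) a : der T (Or a (Neg a)).
Proof.
set e := Or a (Neg a).
suff: der T (Neg (Neg e)) by move=> /der_MP; apply; apply/der_ax/prop_neg_elim.
apply: (@der_negI _ _ _ e); last exact: der_hypU.
(* Under [Neg e], assuming [a] yields [e]; hence [Neg a], and so [e] once more. *)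
apply/der_orr/(@der_negI _ _ _ e); last exact/der_wkn/der_hypU.
exact/der_orl/der_hypU.
Qed.

Lemma der_cases Phi (T : set (form Phi)) a c :
  der (T `|` [set a]) c -> der (T `|` [set Neg a]) c -> der T c.
Proof. exact/der_orE/der_em. Qed.

(* [X = set0] covers the empty chain. *)
Lemma der_chain Phi (T : set (form Phi)) (F : set (set (form Phi))) a :
  total_on F subset -> der (T `|` \bigcup_(X in F) X) a ->
  exists2 X, X = set0 \/ F X & der (T `|` X) a.
Proof.
move=> Ftot; elim=> {a} [a ax|a [Ta|[X FX Xa]]|a b _ [X FX Xa] _ [Y FY Yb]].
- by exists set0; [left|exact: der_ax].
- by exists set0; [left|apply: der_hyp; left].
- by exists X; [right|apply: der_hyp; right].
- have [XY|YX] : X `<=` Y \/ Y `<=` X.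
  + case: FX => [->|FX]; first by left; exact: sub0set.
    by case: FY => [->|FY]; [right; exact: sub0set|exact: Ftot].
  + by exists Y => //; apply: der_MP Yb; apply: der_sub Xa; exact: setUS.
  + by exists X => //; apply: der_MP Xa _; apply: der_sub Yb; exact: setUS.
Qed.

(** * Maximal consistent sets and Lindenbaum's lemma *)

Record mcs Phi (M : set (form Phi)) : Prop := Mcs {
  mcs_der : forall a, der M a -> M a;
  mcs_neg : forall a, M (Neg a) <-> ~ M a
}.

Lemma mcs_MP Phi (M : set (form Phi)) a b : mcs M -> M a -> M (Imp a b) -> M b.
Proof.
move=> mM Ma Mab; apply: mcs_der => //.
exact: der_MP (der_hyp Ma) (der_hyp Mab).
Qed.

Lemma mcs_or Phi (M : set (form Phi)) a b :
  mcs M -> (M (Or a b) <-> M a \/ M b).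
Proof.
move=> mM; split=> [Mab|[Ma|Mb]]; last 2 first.
- by apply: mcs_der => //; apply/der_orl/der_hyp.
- by apply: mcs_der => //; apply/der_orr/der_hyp.
have [|/(mcs_neg mM) Mna] := pselect (M a); first by left.
right; apply: mcs_der => //; apply: (der_orE (der_hyp Mab)).
  by apply: der_exfalso (der_hypU _ _) _; exact/der_wkn/der_hyp.
exact: der_hypU.
Qed.

Lemma mcs_and Phi (M : set (form Phi)) a b :
  mcs M -> (M (And a b) <-> M a /\ M b).
Proof.
move=> mM; rewrite (mcs_neg mM) (mcs_or _ _ mM) !(mcs_neg mM).
by rewrite not_orE !notK.
Qed.

Lemma lindenbaum Phi (T : set (form Phi)) c :
  ~ der T c -> exists M, [/\ mcs M, T `<=` M & ~ M c].
Proof.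
(* Zorn is applied to the sets that can be added to [T] without deriving [c]; derivations being
   finite, unions of chains stay among them. *)
move=> Tc; have [|A [/= Ac maxA]] :=
  @Zorn_bigcup _ [set X | ~ der (T `|` X) c].
  move=> F FP Ftot /= /(der_chain Ftot)[X [->|/FP //]].
  by rewrite setU0.
have maxM a : ~ (T `|` A) a -> der ((T `|` A) `|` [set a]) c.
  move=> nMa; apply: contrapT; rewrite -setUA; apply: maxA.
  split; first exact: subsetUl.
  by move=> /(_ a) Aa; apply: nMa; right; apply: Aa; right.
exists (T `|` A); split; [split| |]; last 2 first.
- exact: subsetUl.
- by move=> /der_hyp.
- move=> a Ma; apply: contrapT => /maxM/der_deduction ac.
  exact/Ac/(der_MP Ma ac).
- move=> a; split=> [Mna Ma|nMa].
    by apply: Ac; apply: der_exfalso (der_hyp Ma) (der_hyp Mna).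
  (* If both [a] and [Neg a] were missing, each would derive [c] when added, and a case distinction
     would derive [c] outright. *)
  apply: contrapT => nMna; apply: Ac.
  exact: der_cases (maxM _ nMa) (maxM _ nMna).
Qed.

(** * Worlds, objective formulas and propositional completeness *)

Definition world_of Phi (M : set (form Phi)) : world Phi :=
  fun p => `[< M (Var p) >].

Definition full_situation Phi (w : world Phi) : ext_situation Phi :=
  ExtSituation w (setUid [set: world Phi]).

Lemma models_objective Phi (s t : ext_situation Phi) a :
  objective a -> actual s = actual t -> (models s a <-> models t a).
Proof.
move=> + st; elim: a => //= [p _|a IHa /IHa ->//|a IHa b IHb /andP[/IHa-> /IHb->]//].
by rewrite st.
Qed.

Lemma models_subjective Phi (s : ext_situation Phi) w a :
  subjective a -> (models (move_to s w) a <-> models s a).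
Proof.
by elim: a => //= [a IHa /IHa ->//|a IHa b IHb /andP[/IHa-> /IHb->]].
Qed.

Lemma models_imp Phi (s : ext_situation Phi) a b :
  models s (Imp a b) <-> (models s a -> models s b).
Proof. by rewrite /= implyE. Qed.

Lemma models_and Phi (s : ext_situation Phi) a b :
  models s (And a b) <-> models s a /\ models s b.
Proof. by rewrite /= not_orE !notK. Qed.

Lemma mcs_models_objective Phi (M : set (form Phi)) a : mcs M -> objective a ->
  (models (full_situation (world_of M)) a <-> M a).
Proof.
move=> mM; elim: a => //= [p _|a IHa /IHa|a IHa b IHb /andP[/IHa oa /IHb ob]].
- by split=> /asboolP.
- by rewrite (mcs_neg mM) => ->.
- by rewrite (mcs_or _ _ mM) oa ob.
Qed.

Fixpoint erase Phi (a : form Phi) : form Phi :=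
  match a with
  | Var p => Var p
  | Neg b => Neg (erase b)
  | Or b c => Or (erase b) (erase c)
  | L b | N b => erase b
  end.

Lemma objective_erase Phi (a : form Phi) : objective (erase a).
Proof. by elim: a => //= a -> b ->. Qed.

Lemma erase_id Phi (a : form Phi) : objective a -> erase a = a.
Proof.
by elim: a => //= [a IHa /IHa ->//|a IHa b IHb /andP[/IHa-> /IHb->]].
Qed.

(* Erasing the modalities turns a derivation into one using only objective
   formulas, so [der set0] is conservative over [prop_provable]. *)
Lemma der0_prop_provable Phi (a : form Phi) :
  der set0 a -> prop_provable (erase a).
Proof.
elim=> {a} [a ax|//|a b _ IHa _ IHb]; last exact: prop_MP IHa IHb.
(* Erasure commutes with [Neg] and [Or], so it sends an instance of a scheme to an instance of the
   same scheme. *)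
by apply: prop_ax; [exact: objective_erase|case: ax => *; constructor].
Qed.

Lemma prop_completeness Phi (a : form Phi) : objective a ->
  (forall w, models (full_situation w) a) -> prop_provable a.
Proof.
move=> oa va; rewrite -(erase_id oa); apply: der0_prop_provable.
apply: contrapT => /lindenbaum[M [mM _]]; apply.
exact/(mcs_models_objective mM oa).
Qed.

(** * Soundness *)

Lemma prop_axiom_sound Phi (s : ext_situation Phi) a :
  prop_axiom a -> models s a.
Proof.
case=> *; rewrite !models_imp /=; try tauto.
exact: contrapT.
Qed.

Lemma soundness Phi (a : form Phi) : provable a -> forall s, models s a.
Proof.
elim=> {a} [a ax s|a b s|a b s|a sa s|a oa ca s|a b _ IHa _ IHb s
  |a _ IHa s w _|a _ IHa s w _]; last 2 first.
- exact: IHa.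
- exact: IHa.
- exact: prop_axiom_sound.
- rewrite !models_imp => ab sa w sw.
  by have /models_imp := ab w sw; apply; exact: sa.
- rewrite !models_imp => ab sa w sw.
  by have /models_imp := ab w sw; apply; exact: sa.
- rewrite models_imp models_and => ssa.
  by split=> w _; apply/models_subjective.
(* If [N a] and [L a] both hold, the cover makes the objective formula [a] true at every world; then
   [Neg (Neg a)] is provable, against the consistency of [Neg a]. *)
- rewrite models_imp => Na La; apply: ca; apply: prop_completeness => // w.
  have aw : models (move_to s w) a.
    have : (WL s `|` WN s) w by rewrite WL_WN_cover.
    by case=> [/La|/Na].
  by apply; exact: (models_objective (a := a) oa _).1 aw.
- by move: (IHb s) (IHa s); rewrite models_imp; exact.
Qed.

(** * Modalities and successors of a maximal consistent set *)

Lemma prop_provable_provable Phi (a : form Phi) : prop_provable a -> provable a.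
Proof.
by elim=> {a} [a _ /ax_A1//|a b _ IHa _ IHb]; exact: rule_MP IHa IHb.
Qed.

Lemma der_provable Phi (a : form Phi) : der (@provable Phi) a -> provable a.
Proof.
by elim=> {a} [a /ax_A1//|//|a b _ IHa _ IHb]; exact: rule_MP IHa IHb.
Qed.

(** Collects what A2 to A4 and necessitation give alike for [L] and [N], so that one argument serves
    both. *)
Record box_closed Phi (G : set (form Phi)) (B : form Phi -> form Phi) : Prop :=
  BoxClosed {
    box_nec : forall a, provable a -> G (B a);
    box_K : forall a b, G (B (Imp a b)) -> G (B a) -> G (B b);
    box_subjective : forall a, subjective a -> G a -> G (B a)
  }.

Lemma mcs_box_closed Phi (G : set (form Phi)) :
  mcs G -> @provable Phi `<=` G -> box_closed G (@L Phi) /\ box_closed G (@N Phi).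
Proof.
move=> mG pG; split; split=> [a pa|a b Gab Ga|a sa Ga].
- exact/pG/rule_NecL.
- by apply: (mcs_MP mG Ga); apply: (mcs_MP mG Gab); apply/pG/ax_A2.
- by have /(mcs_and _ _ mG)[] := mcs_MP mG Ga (pG _ (ax_A4 sa)).
- exact/pG/rule_NecN.
- by apply: (mcs_MP mG Ga); apply: (mcs_MP mG Gab); apply/pG/ax_A3.
- by have /(mcs_and _ _ mG)[] := mcs_MP mG Ga (pG _ (ax_A4 sa)).
Qed.

Lemma der_box Phi (G : set (form Phi)) B a :
  box_closed G B -> der [set b | G (B b)] a -> G (B a).
Proof.
move=> bG; elim=> {a} [a ax|//|a b _ IHa _ IHb].
  exact/(box_nec bG)/ax_A1.
exact: (box_K bG IHb IHa).
Qed.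

Definition box_successor Phi (G : set (form Phi)) (B : form Phi -> form Phi)
    (M : set (form Phi)) : Prop :=
  mcs M /\ [set a | G (B a)] `<=` M.

Definition box_worlds Phi (G : set (form Phi)) B : set (world Phi) :=
  [set w | exists2 M, box_successor G B M & world_of M = w].

(** A4 gives one direction; the other is A4 for [Neg a], which is subjective too. *)
Lemma box_successor_subjective Phi (G : set (form Phi)) B M a :
  mcs G -> box_closed G B -> box_successor G B M -> subjective a ->
  (G a <-> M a).
Proof.
move=> mG bG [mM GM] sa; split=> [Ga|Ma].
  exact/GM/(box_subjective bG).
apply: contrapT => /(mcs_neg mG) Gna.
have /(mcs_neg mM) : M (Neg a) by apply/GM/(box_subjective bG).
exact.
Qed.

(** The formulas whose box lies in [G] are closed under derivation, so they do not derive [a] and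
    Lindenbaum's lemma applies. *)
Lemma box_witness Phi (G : set (form Phi)) B a :
  box_closed G B -> ~ G (B a) -> exists2 M, box_successor G B M & ~ M a.
Proof.
move=> bG nGa; have /lindenbaum[M [mM GM Ma]] : ~ der [set b | G (B b)] a.
  by move=> /(der_box bG).
by exists M.
Qed.

(** * Covering all worlds by compactness *)

(** All objective formulas rather than literals, so that finitely many can be merged into one
    disjunction. *)
Definition refuted Phi (w : world Phi) (a : form Phi) : Prop :=
  objective a /\ ~ models (full_situation w) a.

Lemma refuted_or Phi (w : world Phi) a b :
  refuted w a -> refuted w b -> refuted w (Or a b).
Proof. by move=> [oa wa] [ob wb]; split=> /=; [rewrite oa ob|case]. Qed.

Lemma refuted_Var Phi (w : world Phi) p :
  refuted w (if w p then Neg (Var p) else Var p).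
Proof. by case E : (w p); split=> //=; rewrite E. Qed.

(* Only finitely many of the refuted formulas are used, and their disjunction
   is again refuted. *)
Lemma der_refuted Phi (w : world Phi) (p : Phi) (T : set (form Phi)) b :
  der (T `|` [set Neg a | a in refuted w]) b ->
  exists2 a, refuted w a & der (T `|` [set Neg a]) b.
Proof.
(* If [a] entails [a'], then [Neg a'] derives [Neg a] and can replace it as a hypothesis. *)
have wkn a a' c : der (T `|` [set Neg a]) c ->
    (forall S, der S a -> der S a') -> der (T `|` [set Neg a']) c.
  move=> ac aa'; apply: der_cut ac => d [Td|->]; first by apply: der_hyp; left.
  apply: (@der_negI _ _ _ a'); first exact/aa'/der_hypU.
  exact/der_wkn/der_hypU.
have wp := refuted_Var w p.
elim=> {b} [b ax|b [Tb|[a wa <-]]|b c _ [a wa ab] _ [a' wa' abc]].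
- by exists (if w p then Neg (Var p) else Var p) => //; exact: der_ax.
- by exists (if w p then Neg (Var p) else Var p) => //; exact/der_wkn/der_hyp.
- by exists a => //; exact: der_hypU.
- exists (Or a a'); first exact: refuted_or.
  apply: (@der_MP _ _ b); first by apply: wkn ab _ => S; exact: der_orl.
  by apply: wkn abc _ => S; exact: der_orr.
Qed.

Lemma box_refuted Phi (G : set (form Phi)) B (w : world Phi) (p : Phi) :
  box_closed G B -> ~ box_worlds G B w -> exists2 a, refuted w a & G (B a).
Proof.
move=> bG Gw; set c := if w p then Neg (Var p) else Var p.
have wc : refuted w c by exact: refuted_Var.
set T := [set a | G (B a)].
have : der (T `|` [set Neg a | a in refuted w]) c.
  (* Otherwise some successor of [G] would contain every negated refuted formula; these fix the
     value of each variable, so its world would be [w]. *)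
  apply: contrapT => /lindenbaum[M [mM TM _]]; apply: Gw; exists M.
    by split=> // a Ga; apply: TM; left.
  apply/funext => q; apply/asboolP; case E : (w q).
    have /(mcs_neg mM) : M (Neg (Neg (Var q))).
      apply: TM; right; exists (Neg (Var q)) => //.
      by split=> //=; rewrite E.
    by move=> nMq; apply: contrapT => /(mcs_neg mM).
  apply/(mcs_neg mM); apply: TM; right; exists (Var q) => //.
  by split=> //=; rewrite E.
move=> /(der_refuted p)[a wa ac]; exists (Or a c); first exact: refuted_or.
apply: der_box bG _; apply: (@der_cases _ _ a); first exact/der_orl/der_hypU.
exact: der_orr.
Qed.

Lemma mcs_cover Phi (p : Phi) (G : set (form Phi)) :
  mcs G -> @provable Phi `<=` G ->
  box_worlds G (@L Phi) `|` box_worlds G (@N Phi) = [set: world Phi].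
Proof.
move=> mG pG; have [bL bN] := mcs_box_closed mG pG.
apply/seteqP; split=> // w _; apply: contrapT; rewrite /setU /= not_orE => -[].
move=> /(box_refuted p bL)[a wa La] /(box_refuted p bN)[b wb Nb].
have [oc wc] := refuted_or wa wb.
have orL : G (L (Or a b)).
  by apply: der_box bL _; apply/der_orl/der_hyp.
have orN : G (N (Or a b)).
  by apply: der_box bN _; apply/der_orr/der_hyp.
(* Were [Neg (Neg (Or a b))] provable, soundness would make [Or a b] true at [w]. *)
have cc : prop_consistent (Neg (Or a b)).
  move=> /prop_provable_provable/soundness/(_ (full_situation w)).
  exact.
have /(mcs_neg mG) := mcs_MP mG orN (pG _ (ax_A5 (a := Or a b) oc cc)).
exact.
Qed.

(** * Truth lemma and completeness *)

(** [G] fixes the two sets of worlds while [M] varies, because the modal cases of the induction pass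
    to other successors of [G]. *)
Lemma truth_lemma Phi (G : set (form Phi)) (s : ext_situation Phi) a :
  mcs G -> @provable Phi `<=` G ->
  WL s = box_worlds G (@L Phi) -> WN s = box_worlds G (@N Phi) ->
  forall M, mcs M -> (forall b, subjective b -> (G b <-> M b)) ->
  (models (move_to s (world_of M)) a <-> M a).
Proof.
move=> mG pG sL sN; have [bL bN] := mcs_box_closed mG pG.
have box B b : box_closed G B ->
    (forall M, mcs M -> (forall b, subjective b -> (G b <-> M b)) ->
      (models (move_to s (world_of M)) b <-> M b)) ->
    (forall w, box_worlds G B w -> models (move_to s w) b) <-> G (B b).
  move=> bG IH; split=> [sb|Gb w [M GM <-]].
    apply: contrapT => /(box_witness bG)[M GM]; apply.
    apply/IH; [by case: GM|by move=> *; exact: box_successor_subjective GM _|].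
    by apply: sb; exists M.
  apply/IH; [by case: GM|by move=> *; exact: box_successor_subjective GM _|].
  by case: GM => _; exact.
elim: a => [p|a IHa|a IHa b IHb|a IHa|a IHa] M mM GM /=.
- by split=> /asboolP.
- by rewrite (mcs_neg mM) IHa.
- by rewrite (mcs_or _ _ mM) IHa // IHb.
(* [L a] is itself subjective, so its membership can be read off [G] instead of [M]. *)
- by rewrite -(GM (L a)) // sL; exact: box.
- by rewrite -(GM (N a)) // sN; exact: box.
Qed.

(* The language is empty when [Phi] is. *)
Lemma form_inhabited Phi (a : form Phi) : inhabited Phi.
Proof. by elim: a. Qed.

Theorem theorem2p3 (Phi : Type) (alpha : form Phi) :
  provable alpha <-> forall s : ext_situation Phi, models s alpha.
Proof.
split=> [|valid]; first exact: soundness.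
apply: contrapT => npa; have [p] := form_inhabited alpha.
have /lindenbaum[G [mG pG]] : ~ der (@provable Phi) alpha.
  by move=> /der_provable.
(* The truth lemma at [M = G] turns validity at this situation into membership of [alpha] in [G]. *)
pose s := ExtSituation (world_of G) (mcs_cover p mG pG); apply.
by apply/(@truth_lemma _ G s).
Qed.
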